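(* Let $\beta\equiv\beta^{(4)}$ be a normalized nc sequence with a moment matrix $\mathcal M_2$ of rank 5 satisfying the column relations $\mathbb X\mathbb Y+\mathbb Y\mathbb X=\mathbf 0$ and $\mathbb Y^2-\mathbb X^2=\mathbf 1$. Then $\beta$ admits a nc measure exactly in the following cases: (1) $\mathcal M_2$ is positive semidefinite and $\beta_X=\beta_Y=0$. In this case the minimal measure is unique (up to orthogonal equivalence) and of type $(2,1)$. (2) $\mathcal M_2$ is positive semidefinite and $$\beta_X=0,\qquad0<|\beta_Y|<1,\qquad\beta_{X^4}\ge\frac{\beta_{X^2}^2}{1-|\beta_Y|}.$$ In this case the minimal measure is unique (up to orthogonal equivalence); it is of type $(1,1)$ if and only if $\beta_{X^4}=\frac{\beta_{X^2}^2}{1-|\beta_Y|}$, and otherwise it is of type $(2,1)$.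
   Context: Words are elements of the free monoid on noncommuting letters $X,Y$; $|w|$ is the length of $w$, $w^*$ its reverse, and $v,w$ are cyclically equivalent if $v$ is a cyclic permutation of $w$. A sequence $\beta\equiv\beta^{(4)}=(\beta_w)_{|w|\le4}$ is a family of real numbers with $\beta_v=\beta_w$ for cyclically equivalent $v,w$ and $\beta_w=\beta_{w^*}$. It is normalized if $\beta_1=1$, and a nc sequence if $\beta_{X^2Y^2}\ne\beta_{XYXY}$. Its moment matrix $\mathcal M_2$ is the symmetric $7\times7$ matrix with rows and columns indexed by $1,X,Y,X^2,XY,YX,Y^2$ and $(U,V)$ entry $\beta_{U^*V}$; the column indexed by $w$ is denoted $w(\mathbb X,\mathbb Y)$, $\mathbf 1$ is the column indexed by the empty word, and ''satisfies a relation'' means that the corresponding linear relation between columns holds. A representing measure for $\beta$ consists of finitely many pairs $(A_i,B_i)$ (atoms) of real symmetric $t_i\times t_i$ matrices ($t_i$ is the size) and numbers $\lambda_i>0$ (densities) with $\sum_i\lambda_i=1$ and $\beta_w=\sum_i\lambda_i\mathrm{Tr}(w(A_i,B_i))$ for all $|w|\le4$, where $\mathrm{Tr}(A)=\frac1t\mathrm{tr}(A)$ for $A\in\mathbb R^{t\times t}$. It is of type $(m_1,\dots,m_r)$ if it has exactly $m_i$ atoms of size $i$ and $m_r\neq0$. It is minimal if no other representing measure has smaller type, where types are compared first by $r$, then by $m_r$, then $m_{r-1}$, ..., then $m_1$. $\beta$ admits a nc measure if it has a minimal representing measure of type $(m_1,\dots,m_r)$ with $r>1$. Orthogonal equivalence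 means replacing atoms $(A,B)$ by $(UAU^t,UBU^t)$ with $U$ orthogonal. *)

(* Defs.v *)
From HB Require Import structures.
From mathcomp Require Import all_boot all_order all_algebra.
From mathcomp Require Import reals.

Set Implicit Arguments.
Unset Strict Implicit.
Unset Printing Implicit Defensive.

Import Order.TTheory GRing.Theory Num.Theory.

Local Open Scope ring_scope.

(* A word in the letters X, Y is a sequence of booleans; the involution w^* is *)
(* [rev w] and U^* V is [rev U ++ V].                                          *)
Notation letter := bool.
Notation word := (seq letter).
Definition X : letter := false.
Definition Y : letter := true.

Definition cyclically_equivalent (v w : word) : Prop := exists n, v = rot n w.

Section Moments.
Variable R : realType.

(* A sequence beta^(4) is a total function on words, of which only the values  *)
(* at words of length at most 4 are ever constrained or used.                  *)
Implicit Type beta : word -> R.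

Definition tracial_sequence4 beta : Prop :=
  (forall v w : word, (size v <= 4)%N -> (size w <= 4)%N ->
     cyclically_equivalent v w -> beta v = beta w) /\
  (forall w : word, (size w <= 4)%N -> beta w = beta (rev w)).

Definition normalized beta : Prop := beta [::] = 1.

Definition nc_sequence beta : Prop :=
  beta [:: X; X; Y; Y] <> beta [:: X; Y; X; Y].

Definition words2 : seq word :=
  [:: [::]; [:: X]; [:: Y]; [:: X; X]; [:: X; Y]; [:: Y; X]; [:: Y; Y]].

Definition moment_matrix beta : 'M[R]_7 :=
  \matrix_(i < 7, j < 7) beta (rev (nth [::] words2 i) ++ nth [::] words2 j).

(* Meaningful only for [w \in words2]. *)
Definition moment_column beta (w : word) : 'cV[R]_7 :=
  col (inord (index w words2)) (moment_matrix beta).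

Definition positive_semidefinite (n : nat) (M : 'M[R]_n) : Prop :=
  M^T = M /\ forall v : 'cV[R]_n, 0 <= (v^T *m M *m v) 0 0.

Definition word_eval (t : nat) (A B : 'M[R]_t) (w : word) : 'M[R]_t :=
  \prod_(l <- w) (if l == X then A else B).

Definition normalized_trace (t : nat) (A : 'M[R]_t) : R := \tr A / t%:R.

Record atom := Atom {
  atom_size : nat;
  atom_X : 'M[R]_atom_size;
  atom_Y : 'M[R]_atom_size;
  atom_size_gt0 : (0 < atom_size)%N;
  atom_X_sym : atom_X^T = atom_X;
  atom_Y_sym : atom_Y^T = atom_Y
}.

Record measure := Measure {
  natoms : nat;
  atom_of : 'I_natoms -> atom;
  density : 'I_natoms -> R
}.

Definition measure_moment (mu : measure) (w : word) : R :=
  \sum_(i < natoms mu) density i *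
    normalized_trace (word_eval (atom_X (atom_of i)) (atom_Y (atom_of i)) w).

Definition representing_measure beta (mu : measure) : Prop :=
  [/\ forall i : 'I_(natoms mu), 0 < density i,
      \sum_(i < natoms mu) density i = 1 &
      forall w : word, (size w <= 4)%N -> beta w = measure_moment mu w].

(* The type (m_1, ..., m_r) is the sequence m, with m_k = nth 0 m k.-1. As     *)
(* [nth] returns 0 past the end, there are no atoms of size greater than r.    *)
Definition has_type (mu : measure) (m : seq nat) : Prop :=
  last 0%N m != 0%N /\
  forall k : nat,
    #|[set i : 'I_(natoms mu) | atom_size (atom_of i) == k.+1]| = nth 0%N m k.

(* Lexicographic comparison of (r, m_r, m_(r-1), ..., m_1). *)
Definition type_lt (m m' : seq nat) : bool :=
  ((size m :: rev m : seqlexi nat) < (size m' :: rev m' : seqlexi nat))%O.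

Definition minimal_measure beta (mu : measure) : Prop :=
  representing_measure beta mu /\
  forall (nu : measure) (m m' : seq nat),
    representing_measure beta nu -> has_type mu m -> has_type nu m' ->
    ~~ type_lt m' m.

Definition admits_nc_measure beta : Prop :=
  exists (mu : measure) (m : seq nat),
    [/\ minimal_measure beta mu, has_type mu m & (1 < size m)%N].

(* The two orthogonality equations force [atom_size a = atom_size b], so that  *)
(* U is a square orthogonal matrix.                                            *)
Definition orthogonally_equivalent_atoms (a b : atom) : Prop :=
  exists U : 'M[R]_(atom_size b, atom_size a),
    [/\ U *m U^T = 1%:M, U^T *m U = 1%:M,
        atom_X b = U *m atom_X a *m U^T &
        atom_Y b = U *m atom_Y a *m U^T].

Definition orthogonally_equivalent (mu nu : measure) : Prop :=
  exists f : 'I_(natoms mu) -> 'I_(natoms nu),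
    bijective f /\
    forall i : 'I_(natoms mu),
      density (f i) = density i /\
      orthogonally_equivalent_atoms (atom_of i) (atom_of (f i)).

Definition unique_minimal_measure beta : Prop :=
  (exists mu : measure, minimal_measure beta mu) /\
  forall mu nu : measure, minimal_measure beta mu -> minimal_measure beta nu ->
    orthogonally_equivalent mu nu.

End Moments.

(* Main.v *)
(** Put x, y, a, c for the moments of X, Y, X^2, X^4; the column relations
    express every moment of length at most 4 through these. Each atom (A, B) of
    a representing measure satisfies AB + BA = 0 and B^2 = 1 + A^2, because the
    weighted sum of the traces of the squares of the defects is a vanishing
    moment. Hence B is invertible and tr A = 0, so x = 0, and B is traceless off
    ker A, which bounds |y| by 1 - 2 tau a + tau^2 c for every tau, that is, by
    1 - a^2 / c at tau = a / c. In size 1 the only atoms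
    are (0, 1) and (0, -1); in size 2 a noncommuting atom is determined up to
    orthogonal equivalence by A^2 = mu^2. A measure with one atom of size 2 must
    therefore give it the density a^2 / c with mu^2 = c / a, and the remaining
    mass 1 - a^2 / c is split between the two points with difference y; one of
    the points disappears exactly when |y| = 1 - a^2 / c. *)

Require Import Defs.
From HB Require Import structures.
From mathcomp Require Import all_boot all_order all_algebra.
From mathcomp Require Import reals.
From mathcomp Require Import ring lra.

Set Implicit Arguments.
Unset Strict Implicit.
Unset Printing Implicit Defensive.

Import Order.TTheory GRing.Theory Num.Theory.

Local Open Scope ring_scope.

(** * Moments up to length 4 under the two column relations *)

Section RelationMoments.
Variable R : realType.
Implicit Type phi : word -> R.

(** One predicate for beta, for a single atom and for a measure, so that any two of them agree up to
    length 4 once their four free parameters do. *)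
Definition relation_moments phi : Prop :=
  [/\ tracial_sequence4 phi, phi [::] = 1,
      forall u, (size u <= 2)%N -> phi (u ++ [:: X; Y]) + phi (u ++ [:: Y; X]) = 0 &
      forall u, (size u <= 2)%N ->
        phi (u ++ [:: Y; Y]) - phi (u ++ [:: X; X]) = phi u].

(** Letter counts decide the value, except for two letters of each kind, where the alternating words
    carry the opposite sign. *)
Definition moment_value (x y a c : R) (w : word) : R :=
  match count_mem X w, count_mem Y w with
  | 0%N, 0%N => 1 | 1%N, 0%N => x | 0%N, 1%N => y
  | 2%N, 0%N => a | 0%N, 2%N => 1 + a | 3%N, 0%N => - x | 0%N, 3%N => y
  | 4%N, 0%N => c | 0%N, 4%N => 1 + 2 * a + c
  | 2%N, 2%N => if (w == [:: X; Y; X; Y]) || (w == [:: Y; X; Y; X])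
            then - (a + c) else a + c
  | _, _ => 0
  end.

Lemma tracial_rot1 phi (l : letter) (u : word) :
  tracial_sequence4 phi -> (size u < 4)%N -> phi (l :: u) = phi (rcons u l).
Proof.
move=> [cyc _] su; apply: cyc; rewrite ?size_rcons //.
by exists (size u); rewrite -cats1 rot_size_cat.
Qed.

(** Up to length 4 the instances of cyclicity and of both relations form a linear system that
    expresses every moment through four of them. *)
Lemma relation_momentsE phi w : relation_moments phi -> (size w <= 4)%N ->
  phi w = moment_value (phi [:: X]) (phi [:: Y]) (phi [:: X; X])
                       (phi [:: X; X; X; X]) w.
Proof.
move=> [tr p1 anti quad].
have cyc l u := tracial_rot1 l (u := u) tr.
have := (anti [::] isT, quad [::] isT, cyc X [:: Y] isT).
rewrite /= p1 => -[[a0 q0] c0].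
have := (anti [:: X] isT, anti [:: Y] isT, quad [:: X] isT, quad [:: Y] isT).
have := (cyc X [:: X; Y] isT, cyc X [:: Y; X] isT, cyc X [:: Y; Y] isT,
         cyc Y [:: X; Y] isT).
rewrite /= => -[[[c1 c2] c3] c4] [[[a1 a2] q1] q2].
have := (anti [:: X; X] isT, anti [:: X; Y] isT, anti [:: Y; X] isT, anti [:: Y; Y] isT,
         quad [:: X; X] isT, quad [:: X; Y] isT, quad [:: Y; X] isT, quad [:: Y; Y] isT).
have := (cyc X [:: X; X; Y] isT, cyc X [:: X; Y; X] isT, cyc X [:: Y; X; X] isT,
         cyc X [:: Y; Y; Y] isT, cyc Y [:: X; Y; Y] isT, cyc Y [:: Y; X; Y] isT).
have := (cyc X [:: X; Y; Y] isT, cyc X [:: Y; Y; X] isT, cyc Y [:: Y; X; X] isT,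
         cyc X [:: Y; X; Y] isT).
rewrite /= => -[[[d1 d2] d3] d4] [[[[[d5 d6] d7] d8] d9] d10]
  [[[[[[[a3 a4] a5] a6] q3] q4] q5] q6].
by move: w => [|[] [|[] [|[] [|[] [|? w]]]]] // _;
   rewrite /moment_value /= ?p1 //; lra.
Qed.
End RelationMoments.

(** * Symmetric pairs with AB + BA = 0 and B^2 = 1 + A^2 *)

Section SymmetricPairs.
Variable R : realType.

(** The squared Frobenius norm; its vanishing is the way matrices are shown to be zero below. *)
Lemma mxtrace_gramE m n (S : 'M[R]_(m, n)) :
  \tr (S^T *m S) = \sum_j \sum_i S i j ^+ 2.
Proof.
apply: eq_bigr => j _; rewrite mxE; apply: eq_bigr => i _.
by rewrite mxE expr2.
Qed.

Lemma mxtrace_gram_ge0 m n (S : 'M[R]_(m, n)) : 0 <= \tr (S^T *m S).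
Proof.
by rewrite mxtrace_gramE; do 2![apply: sumr_ge0 => ? _]; apply: sqr_ge0.
Qed.

Lemma mxtrace_gram_eq0 m n (S : 'M[R]_(m, n)) : \tr (S^T *m S) = 0 -> S = 0.
Proof.
rewrite mxtrace_gramE => /eqP; rewrite psumr_eq0 => [/allP S0|? _]; last first.
  by apply: sumr_ge0 => ? _; apply: sqr_ge0.
apply/matrixP => i j; rewrite mxE.
have := S0 j (mem_index_enum j); rewrite psumr_eq0 => [/allP Sj|? _]; last first.
  exact: sqr_ge0.
by have := Sj i (mem_index_enum i); rewrite sqrf_eq0 => /eqP.
Qed.

Lemma horner_mx_sym n (A : 'M[R]_n.+1) p : A^T = A -> (horner_mx A p)^T = horner_mx A p.
Proof.
move=> sA; elim/poly_ind: p => [|p c IH]; first by rewrite rmorph0 trmx0.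
rewrite rmorphD rmorphM /= horner_mx_X horner_mx_C linearD /= tr_scalar_mx.
by rewrite trmx_mul sA IH; congr (_ + _); apply: comm_mx_horner.
Qed.

(* Q is the orthogonal projection onto the kernel of A, and G a pseudo-inverse *)
(* of A; both are polynomials in A, read off a factorisation of char_poly A.   *)
Lemma kernel_projection n (A : 'M[R]_n) : A^T = A ->
  exists Q G : 'M[R]_n,
    [/\ Q^T = Q, Q *m Q = Q, A *m Q = 0, G *m A = A *m G & 1%:M - Q = A *m G].
Proof.
case: n A => [|n] A sA.
  by exists 0, 0; split; apply/matrixP => - [].
(* Here [char_poly A] is q 'X^m with q.[0] != 0. Writing q = q.[0] + h 'X, the witnesses are Q =
   q(A) / q.[0] and G = - h(A) / q.[0]. *)
have [m [q]] := multiplicity_XsubC (char_poly A) 0.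
rewrite monic_neq0 ?char_poly_monic //= => q0 cpE.
have [h hE] : exists h, q - q.[0]%:P = h * ('X - 0%:P).
  by apply/factor_theorem; rewrite /root !hornerE subrr.
set C := horner_mx A q; set H := horner_mx A h.
have sC : C^T = C by apply: horner_mx_sym.
have CA : C *m A = A *m C by symmetry; apply: comm_mx_horner.
have HA : H *m A = A *m H by symmetry; apply: comm_mx_horner.
have CE : C = q.[0]%:M + H *m A.
  have qE : q = q.[0]%:P + h * 'X by rewrite -['X]subr0 -hE addrC subrK.
  by rewrite /C {1}qE rmorphD rmorphM /= horner_mx_X horner_mx_C.
have CAm : C *m (A ^+ m) = 0.
  have := Cayley_Hamilton A; rewrite cpE subr0 rmorphM rmorphXn /=.
  by rewrite horner_mx_X.
(* Symmetry lowers the exponent m to 1: the Gram matrix of q(A) A^(k+1) contains the factor q(A)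
   A^(k+2). *)
have C0 : C *m A = 0.
  elim: m CAm {cpE} => [|k IH] Ck; first by rewrite expr0 mulmx1 in Ck; rewrite Ck mul0mx.
  case: k IH Ck => [_|k IH Ck]; first by rewrite expr1.
  apply: IH; apply: mxtrace_gram_eq0.
  rewrite trmx_mul sC.
  have -> : (A ^+ k.+1)^T = A ^+ k.+1.
    by have := horner_mx_sym ('X ^+ k.+1 : {poly R}) sA; rewrite rmorphXn /= horner_mx_X.
  have -> : (A ^+ k.+1) *m C *m (C *m A ^+ k.+1) = A ^+ k *m C *m (C *m A ^+ k.+2).
    have -> : A ^+ k.+2 = A *m A ^+ k.+1 by rewrite exprS.
    have {1}-> : A ^+ k.+1 = A ^+ k *m A by rewrite exprSr.
    rewrite -!mulmxA; congr (_ *m _).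
    by rewrite !mulmxA -CA -(mulmxA C A C) -CA !mulmxA.
  by rewrite Ck mulmx0 mxtrace0.
have QE : 1%:M - q.[0]^-1 *: C = A *m (- (q.[0]^-1 *: H)).
  rewrite CE scalerDr opprD addrA scale_scalar_mx mulVf // subrr add0r.
  by rewrite mulmxN -scalemxAr HA.
exists (q.[0]^-1 *: C), (- (q.[0]^-1 *: H)); split=> //.
- by rewrite linearZ /= sC.
- rewrite -[X in _ *m X](opprK) -[- (_ *: C)](addKr 1%:M) QE.
  rewrite opprD opprK mulmxDr mulmx1 mulmxN mulmxA -scalemxAl C0.
  by rewrite scaler0 mul0mx oppr0 addr0.
- by rewrite -scalemxAr -CA C0 scaler0.
- by rewrite mulNmx mulmxN -scalemxAl -scalemxAr HA.
Qed.

(** Anticommutation flips the sign, while cyclicity and GA = AG bring back the same trace. When AG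
    is the projection off ker A, this makes B traceless there. *)
Lemma anticommute_trace0 n (A B G : 'M[R]_n) :
  A *m B + B *m A = 0 -> G *m A = A *m G -> \tr (B *m A *m G) = 0.
Proof.
move=> /eqP; rewrite addr_eq0 => /eqP AB GA.
have E : \tr (B *m A *m G) = - \tr (B *m A *m G).
  rewrite -[in LHS](opprK (B *m A)) -AB mulNmx linearN /= -[in LHS]mulmxA.
  by rewrite mxtrace_mulC -!mulmxA GA.
lra.
Qed.

(** Named after the hyperbola y^2 - x^2 = 1. *)
Definition hyperbolic_pair n (A B : 'M[R]_n) : Prop :=
  [/\ A^T = A, B^T = B, A *m B + B *m A = 0 & B *m B = 1%:M + A *m A].

(** B^2 = 1 + A^2 makes B injective, so its kernel projection is 0 and BG = 1; then tr A = tr (ABG)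
    vanishes by anticommutation. *)
Lemma hyperbolic_trace0 n (A B : 'M[R]_n) : hyperbolic_pair A B -> \tr A = 0.
Proof.
move=> [sA sB AB BB]; have [Q [G [sQ QQ BQ GB QE]]] := kernel_projection sB.
have Q0 : Q = 0.
  apply: mxtrace_gram_eq0.
  have E : \tr (Q^T *m Q) + \tr ((A *m Q)^T *m (A *m Q)) = 0.
    rewrite -linearD /= trmx_mul sA -mulmxA -mulmxDr (mulmxA A).
    by rewrite -[X in X + _]mul1mx -mulmxDl -BB -mulmxA BQ !mulmx0 mxtrace0.
  have := mxtrace_gram_ge0 Q; have := mxtrace_gram_ge0 (A *m Q); lra.
rewrite -[A]mulmx1 -[1%:M](subr0) -Q0 QE mulmxA.
by apply: anticommute_trace0 => //; rewrite addrC.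
Qed.

(* With Q the projection onto ker A and P = 1 - Q: tr (B P) = 0, B^2 Q = Q and *)
(* (B Q - e Q)^T (B Q - e Q) >= 0 give |tr B| <= tr Q, while the right-hand     *)
(* side minus tr Q is tr (P - tau A^2)^2.                                      *)
Lemma hyperbolic_trace_bound n (A B : 'M[R]_n) (tau : R) : hyperbolic_pair A B ->
  `|\tr B| <= n%:R - 2 * tau * \tr (A *m A) + tau ^+ 2 * \tr (A *m A *m (A *m A)).
Proof.
move=> [sA sB AB BB]; have [Q [G [sQ QQ AQ GA PE]]] := kernel_projection sA.
have QA : Q *m A = 0 by rewrite -[LHS]trmxK trmx_mul sA sQ AQ trmx0.
have trB : \tr B = \tr (B *m Q).
  have := anticommute_trace0 AB GA.
  by rewrite -mulmxA -PE mulmxBr mulmx1 linearB /= => /eqP; rewrite subr_eq0 => /eqP.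
have sq e : 0 <= (1 + e ^+ 2) * \tr Q - 2 * e * \tr (B *m Q).
  have := mxtrace_gram_ge0 (Q - e *: (B *m Q)).
  suff -> : \tr ((Q - e *: (B *m Q))^T *m (Q - e *: (B *m Q))) =
            (1 + e ^+ 2) * \tr Q - 2 * e * \tr (B *m Q) by [].
  have -> : (Q - e *: (B *m Q))^T = Q - e *: (Q *m B).
    by rewrite linearB linearZ /= trmx_mul sQ sB.
  rewrite mulmxBl !mulmxBr QQ.
  rewrite -!scalemxAl -!scalemxAr !mulmxA.
  have -> : Q *m B *m B *m Q = Q.
    by rewrite -(mulmxA Q) BB mulmxDr mulmx1 mulmxDl QQ -!mulmxA AQ !mulmx0 addr0.
  have -> : Q *m B *m Q = Q *m (B *m Q) by rewrite mulmxA.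
  rewrite !linearB /= !linearZ /= (mxtrace_mulC Q (B *m Q)) -mulmxA QQ.
  by ring.
have := mxtrace_gram_ge0 (1%:M - Q - tau *: (A *m A)).
have -> : \tr ((1%:M - Q - tau *: (A *m A))^T *m (1%:M - Q - tau *: (A *m A))) =
   n%:R - \tr Q - 2 * tau * \tr (A *m A) + tau ^+ 2 * \tr (A *m A *m (A *m A)).
  have -> : (1%:M - Q - tau *: (A *m A))^T = 1%:M - Q - tau *: (A *m A).
    by rewrite !linearB linearZ /= trmx_mul sA sQ tr_scalar_mx.
  rewrite !mulmxBl !mulmxBr !mul1mx !mulmx1 QQ.
  rewrite -!scalemxAl -!scalemxAr !mulmxA QA -(mulmxA _ A Q) AQ !mulmx0 !mul0mx.
  rewrite !scaler0 !linearB /= !linearZ /= mxtrace1 !mxtrace0.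
  by ring.
(* The choices e = 1 and e = -1 bound tr B by tr Q from both sides. *)
move=> H; have := sq 1; have := sq (-1); rewrite -trB => H1 H2.
by rewrite ler_norml; apply/andP; split; lra.
Qed.

End SymmetricPairs.

(** * Moments of atoms and of representing measures *)

Section AtomMoments.
Variable R : realType.
Implicit Types (a : atom R) (mu : measure R) (beta : word -> R).

Definition atom_moment a (w : word) : R :=
  normalized_trace (word_eval (atom_X a) (atom_Y a) w).

Definition hyperbolic_atom a : Prop := hyperbolic_pair (atom_X a) (atom_Y a).

Lemma word_eval_cat n (A B : 'M[R]_n) u v :
  word_eval A B (u ++ v) = word_eval A B u *m word_eval A B v.
Proof. by rewrite /word_eval big_cat. Qed.

Lemma word_eval_rcons n (A B : 'M[R]_n) u (l : letter) :
  word_eval A B (rcons u l) = word_eval A B u *m (if l == X then A else B).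
Proof. by rewrite -cats1 word_eval_cat {2}/word_eval big_seq1. Qed.

Lemma word_eval_cons n (A B : 'M[R]_n) u (l : letter) :
  word_eval A B (l :: u) = (if l == X then A else B) *m word_eval A B u.
Proof. by rewrite /word_eval big_cons. Qed.

Lemma word_eval_nil n (A B : 'M[R]_n) : word_eval A B [::] = 1%:M.
Proof. by rewrite /word_eval big_nil. Qed.

Definition word_evalE := (word_eval_cons, word_eval_nil, mulmx1).

Lemma word_eval_rev n (A B : 'M[R]_n) w : A^T = A -> B^T = B ->
  word_eval A B (rev w) = (word_eval A B w)^T.
Proof.
move=> sA sB; elim: w => [|l w IH]; first by rewrite word_eval_nil trmx1.
rewrite rev_cons word_eval_rcons IH word_eval_cons trmx_mul.
by case: ifP => _; rewrite ?sA ?sB.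
Qed.

Lemma normalized_traceD n (A B : 'M[R]_n) :
  normalized_trace (A + B) = normalized_trace A + normalized_trace B.
Proof. by rewrite /normalized_trace linearD mulrDl. Qed.

Lemma normalized_traceB n (A B : 'M[R]_n) :
  normalized_trace (A - B) = normalized_trace A - normalized_trace B.
Proof. by rewrite /normalized_trace linearB mulrBl. Qed.

Lemma normalized_trace_gram_ge0 m n (S : 'M[R]_(m, n)) :
  0 <= normalized_trace (S^T *m S).
Proof. by rewrite divr_ge0 ?mxtrace_gram_ge0 ?ler0n. Qed.

Lemma atom_size_neq0 a : (atom_size a)%:R != 0 :> R.
Proof. by rewrite pnatr_eq0 -lt0n atom_size_gt0. Qed.

Lemma atom_moment_nil a : atom_moment a [::] = 1.
Proof.
by rewrite /atom_moment /normalized_trace word_eval_nil mxtrace1 divff ?atom_size_neq0.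
Qed.

Lemma atom_moment_tracial a : tracial_sequence4 (atom_moment a).
Proof.
split=> [v w _ _ [n ->]|w _]; rewrite /atom_moment /normalized_trace.
  by rewrite /rot word_eval_cat mxtrace_mulC -word_eval_cat cat_take_drop.
by rewrite word_eval_rev ?atom_X_sym ?atom_Y_sym // mxtrace_tr.
Qed.

Lemma atom_relation_moments a : hyperbolic_atom a -> relation_moments (atom_moment a).
Proof.
move=> [_ _ AB BB]; split; [exact: atom_moment_tracial|exact: atom_moment_nil| |].
  move=> u _; rewrite /atom_moment !word_eval_cat !word_evalE /=.
  by rewrite -normalized_traceD -mulmxDr AB mulmx0 /normalized_trace mxtrace0 mul0r.
move=> u _; rewrite /atom_moment !word_eval_cat !word_evalE /=.
by rewrite BB -normalized_traceB -mulmxBr addrK mulmx1.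
Qed.

(** All conditions are linear in the moments, so they pass from the atoms to weighted sums of total
    weight 1. *)
Lemma measure_relation_moments mu : \sum_i density (m := mu) i = 1 ->
  (forall i, hyperbolic_atom (atom_of (m := mu) i)) ->
  relation_moments (measure_moment mu).
Proof.
move=> d1 hyp; have rel i := atom_relation_moments (hyp i).
split; [split| | |].
- move=> v w sv sw vw; apply: eq_bigr => i _; congr (_ * _).
  by have [[cyc _] _ _ _] := rel i; apply: cyc.
- move=> w sw; apply: eq_bigr => i _; congr (_ * _).
  by have [[_ rv] _ _ _] := rel i; apply: rv.
- by rewrite -d1; apply: eq_bigr => i _; have [_ + _ _] := rel i;
    rewrite /atom_moment => ->; rewrite mulr1.
- move=> u su; rewrite -big_split big1 //= => i _; rewrite -mulrDr.
  by have [_ _ + _] := rel i; rewrite /atom_moment => ->; rewrite ?mulr0.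
- move=> u su; rewrite -sumrB; apply: eq_bigr => i _; rewrite -mulrBr.
  by have [_ _ _ +] := rel i; rewrite /atom_moment => ->.
Qed.

(** Turns one vanishing combination of moments into an identity at every atom. *)
Lemma weighted_gram_eq0 mu (S : forall i : 'I_(natoms mu), 'M[R]_(atom_size (atom_of i))) :
  (forall i : 'I_(natoms mu), 0 < density i) ->
  \sum_(i < natoms mu) density i * normalized_trace ((S i)^T *m S i) = 0 ->
  forall i, S i = 0.
Proof.
move=> d0 /eqP; rewrite psumr_eq0 => [/allP S0 i|i _]; last first.
  exact: mulr_ge0 (ltW (d0 i)) (normalized_trace_gram_ge0 _).
apply: mxtrace_gram_eq0; have := S0 i (mem_index_enum i).
rewrite mulf_eq0 gt_eqF //= mulf_eq0 invr_eq0 (negPf (atom_size_neq0 _)) orbF.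
by move/eqP.
Qed.

Lemma representing_hyperbolic beta mu : relation_moments beta ->
  representing_measure beta mu ->
  forall i : 'I_(natoms mu), hyperbolic_atom (atom_of i).
Proof.
move=> rel [d0 d1 rep] i.
have [x [y [a [c bE]]]] : exists x y a c : R, forall w, (size w <= 4)%N ->
    beta w = moment_value x y a c w.
  by do 4!eexists; move=> w; apply: relation_momentsE.
have AB0 := @weighted_gram_eq0 mu (fun i =>
   word_eval (atom_X (atom_of i)) (atom_Y (atom_of i)) [:: X; Y]
   + word_eval (atom_X (atom_of i)) (atom_Y (atom_of i)) [:: Y; X]) d0.
have BB0 := @weighted_gram_eq0 mu (fun i =>
   word_eval (atom_X (atom_of i)) (atom_Y (atom_of i)) [:: Y; Y]
   - word_eval (atom_X (atom_of i)) (atom_Y (atom_of i)) [:: X; X]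
   - word_eval (atom_X (atom_of i)) (atom_Y (atom_of i)) [::]) d0.
have sX := atom_X_sym (atom_of i); have sY := atom_Y_sym (atom_of i).
split=> //.
- have := AB0 _ i; rewrite !word_evalE /=; apply.
  (* The square of XY + YX, expanded: the two alternating words cancel the other two. *)
  transitivity (beta [:: Y; X; X; Y] + beta [:: Y; X; Y; X] + beta [:: X; Y; X; Y]
                + beta [:: X; Y; Y; X]).
    rewrite !rep // /measure_moment -!big_split /=; apply: eq_bigr => j _.
    rewrite -!mulrDr -!normalized_traceD [(_ + _)^T]linearD /=.
    rewrite -!word_eval_rev ?atom_X_sym ?atom_Y_sym //.
    by rewrite mulmxDl !mulmxDr -!word_eval_cat /= !addrA.
  by rewrite !bE // /moment_value /=; ring.
- apply/eqP; rewrite -subr_eq0 opprD addrA; apply/eqP.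
  rewrite (addrAC (_ *m _)).
  have := BB0 _ i; rewrite !word_evalE /=; apply.
  (* The square of Y^2 - X^2 - 1, expanded. *)
  transitivity (beta [:: Y; Y; Y; Y] - beta [:: Y; Y; X; X] - beta [:: Y; Y]
       - (beta [:: X; X; Y; Y] - beta [:: X; X; X; X] - beta [:: X; X])
       - (beta [:: Y; Y] - beta [:: X; X] - beta [::])).
    rewrite !rep // /measure_moment -!sumrB /=; apply: eq_bigr => j _.
    rewrite -!mulrBr -!normalized_traceB [(_ - _)^T]linearB /=.
    rewrite [(_ - word_eval _ _ [:: X; X])^T]linearB /= -!word_eval_rev ?atom_X_sym ?atom_Y_sym //.
    by rewrite !mulmxBl !mulmxBr -!word_eval_cat.
  by rewrite !bE // /moment_value /=; ring.
Qed.

(** The quadratic form at v is the density-weighted trace of p^T p, where p is the polynomial with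
    coefficients v evaluated at each atom. *)
Lemma measure_psd beta mu : tracial_sequence4 beta ->
  representing_measure beta mu -> positive_semidefinite (moment_matrix beta).
Proof.
move=> tr [d0 _ rep].
have sz (i : 'I_7) : (size (nth [::] words2 i) <= 2)%N.
  by case: i => [[|[|[|[|[|[|[|]]]]]]]].
split=> [|v].
  apply/matrixP => i j; rewrite !mxE; have [_ ->] := tr.
    by rewrite rev_cat revK.
  by rewrite size_cat size_rev (leq_add (sz j) (sz i)).
have -> : (v^T *m moment_matrix beta *m v) 0 0 = \sum_(i < natoms mu) density i *
   normalized_trace (
    (\sum_k v k 0 *: word_eval (atom_X (atom_of i)) (atom_Y (atom_of i)) (nth [::] words2 k))^T *m
    (\sum_k v k 0 *: word_eval (atom_X (atom_of i)) (atom_Y (atom_of i)) (nth [::] words2 k))).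
  rewrite mxE; under eq_bigr => k _.
    rewrite mxE mulr_suml; under eq_bigr => j _ do
      rewrite !mxE rep ?size_cat ?size_rev ?(leq_add (sz j) (sz k)) // /measure_moment
              mulr_sumr mulr_suml.
    rewrite exchange_big /=; over.
  rewrite exchange_big /=; apply: eq_bigr => i _.
  rewrite /normalized_trace [(\sum_k _)^T]linear_sum mulmx_sumr [\tr _]linear_sum.
  rewrite mulr_suml mulr_sumr /=.
  apply: eq_bigr => k _.
  rewrite mulmx_suml [\tr _]linear_sum mulr_suml mulr_sumr /=.
  apply: eq_bigr => j _.
  rewrite [(_ *: _)^T]linearZ /= -scalemxAl -scalemxAr !linearZ /=.
  rewrite word_eval_cat word_eval_rev ?atom_X_sym ?atom_Y_sym //.
  by ring.
apply: sumr_ge0 => i _.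
exact: mulr_ge0 (ltW (d0 i)) (normalized_trace_gram_ge0 _).
Qed.

End AtomMoments.

(** * Consequences of rank 5 and of positivity for the moment matrix *)

Section MomentMatrix.
Variable R : realType.
Implicit Type beta : word -> R.

Lemma subcolE n (u v : 'cV[R]_n) i : (u - v) i 0 = u i 0 - v i 0.
Proof. by rewrite !mxE. Qed.

Lemma scalecolE n k (u : 'cV[R]_n) i : (k *: u) i 0 = k * u i 0.
Proof. by rewrite !mxE. Qed.

Lemma moment_columnE beta w (i : 'I_7) : w \in words2 ->
  moment_column beta w i 0 = beta (rev (nth [::] words2 i) ++ w).
Proof.
by move=> w2; rewrite !mxE inordK ?nth_index // (index_mem w words2).
Qed.

Lemma short_words2 (u : word) : (size u <= 2)%N -> u \in words2.
Proof. by move: u => [|[] [|[] [|? u]]]. Qed.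

(** Row [rev u] of a column relation is the relation multiplied on the left by u, and every u of
    length at most 2 arises in this way. *)
Lemma column_relation_moments beta :
  tracial_sequence4 beta -> normalized beta ->
  moment_column beta [:: X; Y] + moment_column beta [:: Y; X] = 0 ->
  moment_column beta [:: Y; Y] - moment_column beta [:: X; X] = moment_column beta [::] ->
  relation_moments beta.
Proof.
move=> tr n1 rel1 rel2.
have idx u : (size u <= 2)%N -> exists i : 'I_7, u = rev (nth [::] words2 i).
  move=> su; have ru : rev u \in words2 by rewrite short_words2 ?size_rev.
  have lt : (index (rev u) words2 < 7)%N by rewrite (index_mem (rev u) words2).
  by exists (Ordinal lt); rewrite nth_index ?revK.
split=> // u /idx[i ->].
  move/matrixP/(_ i 0): rel1; rewrite [LHS]mxE [RHS]mxE.
  by rewrite !moment_columnE.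
move/matrixP/(_ i 0): rel2; rewrite subcolE.
by rewrite !moment_columnE ?cats0.
Qed.

Let e (k : nat) : 'cV[R]_7 := delta_mx (inord k) 0.

Lemma deltaE (k : nat) (i : 'I_7) : (k < 7)%N -> e k i 0 = (i == k :> nat)%:R.
Proof. by move=> k7; rewrite mxE eqxx andbT -val_eqE /= inordK. Qed.

Lemma moment_column_delta beta w :
  moment_column beta w = moment_matrix beta *m e (index w words2).
Proof. by rewrite /moment_column colE. Qed.

(** The kernel has dimension 2 and is spanned by the two given relations. Coordinates 5 and 6 belong
    to YX and Y^2, so the columns 1, X, Y, X^2, XY are independent. *)
Lemma rank5_relation beta (u : 'cV[R]_7) :
  \rank (moment_matrix beta) = 5%N ->
  moment_column beta [:: X; Y] + moment_column beta [:: Y; X] = 0 ->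
  moment_column beta [:: Y; Y] - moment_column beta [:: X; X] = moment_column beta [::] ->
  moment_matrix beta *m u = 0 -> u (inord 5) 0 = 0 -> u (inord 6) 0 = 0 -> u = 0.
Proof.
move=> rk /esym rel1 /eqP; rewrite -subr_eq0 => /eqP/esym rel2 Mu u5 u6.
have := (rel1, rel2); rewrite !moment_column_delta -!mulmxDr -!mulmxBr /= => -[r1 r2].
apply/eqP/contraT => /eqP u0.
have [i ui] : exists i, u i 0 != 0.
  apply/existsP; apply: contraT => /existsPn un; case: u0; apply/matrixP => i j.
  by rewrite ord1 mxE; apply/eqP; rewrite -[_ == _]negbK un.
(* A nonzero u would give K rank 3, since coordinates 5 and 6 separate the two relations from each
   other and from u; but 5 + 3 > 7. *)
pose K := row_mx (e 4 + e 5) (row_mx (e 6 - e 3 - e 0) u).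
have MK : moment_matrix beta *m K = 0 by rewrite !mul_mx_row -r1 -r2 Mu !row_mx0.
have := mulmx0_rank_max MK; rewrite rk.
suff -> : \rank K = 3%N by [].
rewrite -mxrank_tr; apply/eqP/inj_row_free => v vK.
have {}vK : K *m v^T = 0 by rewrite -[K]trmxK -trmx_mul vK trmx0.
rewrite -[v^T]vsubmxK -[dsubmx v^T]vsubmxK !mul_row_col in vK.
set p := usubmx v^T in vK; set q := usubmx (dsubmx v^T) in vK.
set r := dsubmx (dsubmx v^T) in vK.
have ent j : (e 4 + e 5) j 0 * p 0 0 + ((e 6 - e 3 - e 0) j 0 * q 0 0 + u j 0 * r 0 0) = 0.
  by move/matrixP/(_ j 0): vK; rewrite !mxE !big_ord1 !mxE.
have p0 : p 0 0 = 0.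
  by have := ent (inord 5); rewrite u5 !mxE -!val_eqE /= !inordK //=; lra.
have q0 : q 0 0 = 0.
  by have := ent (inord 6); rewrite u6 p0 !mxE -!val_eqE /= !inordK //=; lra.
have r0 : r 0 0 = 0.
  have := ent i; rewrite p0 q0 !mulr0 !add0r => /eqP.
  by rewrite mulf_eq0 (negPf ui) => /eqP.
apply: trmx_inj; rewrite -[v^T]vsubmxK -[dsubmx v^T]vsubmxK -/p -/q -/r.
by rewrite [p]mx11_scalar [q]mx11_scalar [r]mx11_scalar p0 q0 r0 !raddf0 !col_mx0.
Qed.

(** The column of X has only entries 0, x, -x and a, so x = a = 0 would make it a zero column. *)
Lemma rank5_X2_neq0 beta :
  tracial_sequence4 beta -> normalized beta ->
  \rank (moment_matrix beta) = 5%N ->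
  moment_column beta [:: X; Y] + moment_column beta [:: Y; X] = 0 ->
  moment_column beta [:: Y; Y] - moment_column beta [:: X; X] = moment_column beta [::] ->
  beta [:: X] = 0 -> beta [:: X; X] != 0.
Proof.
move=> tr n1 rk rel1 rel2 x0; apply/eqP => a0.
have rel := column_relation_moments tr n1 rel1 rel2.
have : e 1 = 0.
  apply: (rank5_relation rk rel1 rel2); rewrite ?deltaE ?inordK //.
  rewrite -(moment_column_delta beta [:: X]); apply/matrixP => i j.
  rewrite ord1 moment_columnE // mxE (relation_momentsE rel).
    2: by case: i => [[|[|[|[|[|[|[|]]]]]]]].
  by rewrite x0 a0; case: i => [[|[|[|[|[|[|[|]]]]]]]] //= ?;
    rewrite /moment_value /= ?oppr0.
move/matrixP/(_ (inord 1) 0); rewrite deltaE // inordK // mxE /=.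
by apply/eqP; rewrite oner_eq0.
Qed.

(** With x = y = 0 and c = a^2 the column of X^2 would be a times the column of 1. *)
Lemma rank5_X4_neq beta :
  tracial_sequence4 beta -> normalized beta ->
  \rank (moment_matrix beta) = 5%N ->
  moment_column beta [:: X; Y] + moment_column beta [:: Y; X] = 0 ->
  moment_column beta [:: Y; Y] - moment_column beta [:: X; X] = moment_column beta [::] ->
  beta [:: X] = 0 -> beta [:: Y] = 0 ->
  beta [:: X; X; X; X] != beta [:: X; X] ^+ 2.
Proof.
move=> tr n1 rk rel1 rel2 x0 y0; apply/eqP => ca.
have rel := column_relation_moments tr n1 rel1 rel2.
have : e 3 - beta [:: X; X] *: e 0 = 0.
  apply: (rank5_relation rk rel1 rel2); last 2 first.
  - by rewrite !mxE -!val_eqE /= !inordK //= mulr0 subr0.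
  - by rewrite !mxE -!val_eqE /= !inordK //= mulr0 subr0.
  rewrite mulmxBr -scalemxAr -(moment_column_delta beta [:: X; X]).
  rewrite -(moment_column_delta beta [::]); apply/matrixP => i j.
  rewrite ord1 subcolE scalecolE.
  rewrite !moment_columnE // [RHS]mxE cats0.
  set a := beta [:: X; X] in ca *.
  rewrite !(relation_momentsE rel (w := rev _ ++ _)) ?(relation_momentsE rel (w := rev _)).
  all: try by case: i => [[|[|[|[|[|[|[|]]]]]]]].
  rewrite -/a x0 y0 ca.
  by case: i => [[|[|[|[|[|[|[|]]]]]]]] //= ?; rewrite /moment_value /=; ring.
move/matrixP/(_ (inord 3) 0); rewrite !mxE -!val_eqE /= !inordK //=.
by apply/eqP; rewrite mulr0 subr0 oner_eq0.
Qed.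

(** Positivity at the coefficient vectors of X and of X^2 - a. *)
Lemma psd_moments beta : normalized beta -> positive_semidefinite (moment_matrix beta) ->
  0 <= beta [:: X; X] /\ beta [:: X; X] ^+ 2 <= beta [:: X; X; X; X].
Proof.
move=> n1 [sM psd]; set a := beta [:: X; X]; split.
  by have := psd (e 1); rewrite trmx_delta -rowE -colE !mxE !inordK.
have sa : beta (rev [:: X; X]) = a by [].
have := psd (e 3 - a *: e 0).
rewrite [(_ - _)^T]linearB /= [(_ *: _)^T]linearZ /= !trmx_delta.
rewrite mulmxBl mulmxBr -!scalemxAr mulmxBl -!scalemxAl mulmxBl -!scalemxAl.
by rewrite -!rowE -!colE !mxE !inordK //= n1 -/a; lra.
Qed.

End MomentMatrix.

(** * Atoms of sizes 1 and 2 up to orthogonal equivalence *)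

Section SmallAtoms.
Variable R : realType.
Implicit Types (a b : atom R).

Lemma orthogonally_equivalent_atoms_sym a b :
  orthogonally_equivalent_atoms a b -> orthogonally_equivalent_atoms b a.
Proof.
move=> [U [U1 U2 eX eY]]; exists U^T; split; rewrite ?trmxK // ?eX ?eY !mulmxA.
- by rewrite U2 mul1mx -mulmxA U2 mulmx1.
- by rewrite U2 mul1mx -mulmxA U2 mulmx1.
Qed.

Lemma orthogonally_equivalent_atoms_trans a b c :
  orthogonally_equivalent_atoms a b -> orthogonally_equivalent_atoms b c ->
  orthogonally_equivalent_atoms a c.
Proof.
move=> [U [U1 U2 eX eY]] [V [V1 V2 fX fY]]; exists (V *m U).
rewrite trmx_mul fX fY eX eY; split; rewrite !mulmxA //.
- by rewrite -(mulmxA V) U1 mulmx1.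
- by rewrite -(mulmxA U^T) V2 mulmx1.
Qed.

Lemma atom_moment_equivalent a b w :
  orthogonally_equivalent_atoms a b -> atom_moment b w = atom_moment a w.
Proof.
move=> [U [U1 U2 eX eY]]; rewrite /atom_moment /normalized_trace.
have -> : word_eval (atom_X b) (atom_Y b) w =
          U *m word_eval (atom_X a) (atom_Y a) w *m U^T.
  elim: w => [|l w IH]; first by rewrite !word_eval_nil mulmx1 U1.
  rewrite !word_eval_cons IH eX eY !mulmxA.
  by case: ifP => _; rewrite -(mulmxA _ U^T U) U2 mulmx1.
rewrite mxtrace_mulC mulmxA U2 mul1mx; congr (_ / _).
(* The two sizes agree as real numbers, being the traces of U U^T and U^T U. *)
by rewrite -[LHS]mxtrace1 -U1 mxtrace_mulC U2 mxtrace1.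
Qed.

Definition sign_of (e : bool) : R := if e then 1 else -1.

Definition point_atom (e : bool) : atom R :=
  @Atom R 1 0 (sign_of e)%:M isT (trmx0 _ _ _) (tr_scalar_mx _ _).

(** Normal form of the noncommuting pair: B exchanges the eigenlines of A for m and -m. The size
    [1 + 1] allows block computation. *)
Definition swap_X (m : R) : 'M[R]_(1 + 1) := block_mx m%:M 0 0 (- m)%:M.
Definition swap_Y (m : R) : 'M[R]_(1 + 1) :=
  block_mx 0 (Num.sqrt (1 + m ^+ 2))%:M (Num.sqrt (1 + m ^+ 2))%:M 0.

Lemma swap_X_sym m : (swap_X m)^T = swap_X m.
Proof. by rewrite tr_block_mx !trmx0 !tr_scalar_mx. Qed.

Lemma swap_Y_sym m : (swap_Y m)^T = swap_Y m.
Proof. by rewrite tr_block_mx !trmx0 !tr_scalar_mx. Qed.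

Definition swap_atom (m : R) : atom R :=
  @Atom R (1 + 1) (swap_X m) (swap_Y m) isT (swap_X_sym m) (swap_Y_sym m).

Lemma point_atom_hyperbolic e : hyperbolic_atom (point_atom e).
Proof.
split; rewrite /= ?trmx0 ?tr_scalar_mx ?mul0mx ?mulmx0 ?addr0 //.
by rewrite -scalar_mxM; case: e; rewrite /sign_of ?mulrNN mulr1.
Qed.

Lemma swap_atom_hyperbolic m : hyperbolic_atom (swap_atom m).
Proof.
have r0 : 0 <= 1 + m ^+ 2 by rewrite addr_ge0 ?sqr_ge0.
split; rewrite /= ?swap_X_sym ?swap_Y_sym //;
  rewrite /swap_X /swap_Y !mulmx_block !mul0mx !mulmx0 ?addr0 ?add0r -!scalar_mxM.
  rewrite add_block_mx !addr0 -!raddfD /=; set r := Num.sqrt _.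
  have -> : m * r + r * - m = 0 by ring.
  have -> : - m * r + r * m = 0 by ring.
  by rewrite !raddf0 block_mx0.
rewrite -[1%:M]/((1%:M : 'M[R]_(1 + 1))) scalar_mx_block add_block_mx !addr0 -!raddfD /=.
by rewrite -!expr2 sqrrN sqr_sqrtr.
Qed.

Lemma point_atom_moments e :
  [/\ atom_moment (point_atom e) [:: X] = 0,
      atom_moment (point_atom e) [:: Y] = sign_of e,
      atom_moment (point_atom e) [:: X; X] = 0 &
      atom_moment (point_atom e) [:: X; X; X; X] = 0].
Proof.
rewrite /atom_moment !word_evalE /= /normalized_trace !mul0mx.
by rewrite mxtrace_scalar mulr1n !mxtrace0 !mul0r divr1.
Qed.

Lemma swap_atom_moments m :
  [/\ atom_moment (swap_atom m) [:: X] = 0,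
      atom_moment (swap_atom m) [:: Y] = 0,
      atom_moment (swap_atom m) [:: X; X] = m ^+ 2 &
      atom_moment (swap_atom m) [:: X; X; X; X] = m ^+ 4].
Proof.
rewrite /atom_moment !word_evalE /= /normalized_trace /swap_X /swap_Y.
rewrite !mulmx_block !mul0mx !mulmx0 !addr0 !add0r -!scalar_mxM.
rewrite !mxtrace_block !mxtrace_scalar !mxtrace0 !mulr1n subrr addr0 !mul0r.
by split=> //; field.
Qed.

(** In size 1 tracelessness gives A = 0, and B^2 = 1 leaves a sign, read off the trace because that
    makes sense at any size. *)
Lemma hyperbolic_point a : hyperbolic_atom a -> atom_size a = 1%N ->
  orthogonally_equivalent_atoms a (point_atom (0 < \tr (atom_Y a))).
Proof.
rewrite /hyperbolic_atom; case: a => n A B n0 sA sB /= hyp n1.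
move: A B n0 sA sB hyp; rewrite n1.
move=> A B n0 sA sB hyp; have tA := hyperbolic_trace0 hyp; have [_ _ _ BB] := hyp.
have A0 : A = 0 by rewrite [A]mx11_scalar -[A 0 0]mulr1n -mxtrace_scalar -mx11_scalar tA raddf0.
have {}BB : (B 0 0 - 1) * (B 0 0 + 1) = 0.
  move/matrixP/(_ 0 0): BB; rewrite A0 !mxE !big_ord1 !mxE !mulr0 addr0 mulr1n => BB.
  by rewrite -[RHS](subrr 1) -{3}BB; ring.
exists 1%:M; rewrite trmx1 !mul1mx !mulmx1; split=> //=.
have -> : \tr B = B 0 0 by rewrite [in LHS](mx11_scalar B) mxtrace_scalar.
rewrite [RHS]mx11_scalar; congr _%:M.
move/eqP: BB; rewrite mulf_eq0 subr_eq0 addr_eq0 /sign_of.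
by case/orP => /eqP ->; rewrite ?ltr01 ?ltr0N1 // ltNge lerN10.
Qed.

(** Cayley-Hamilton in size 2 with trace zero: the square is scalar, hence equal to its normalized
    trace. *)
Lemma traceless_sqr2 (A : 'M[R]_2) : A^T = A -> \tr A = 0 ->
  A *m A = (normalized_trace (A *m A))%:M.
Proof.
move=> sA; rewrite /normalized_trace /mxtrace !big_ord_recl !big_ord0 => tA.
have s10 : A (lift ord0 ord0) ord0 = A ord0 (lift ord0 ord0) by rewrite -{1}sA mxE.
have tA' : A (lift ord0 ord0) (lift ord0 ord0) = - A ord0 ord0 by lra.
apply/matrixP => i j; rewrite !mxE !big_ord_recl !big_ord0.
by case: (unliftP ord0 i) => [i' ->|->]; case: (unliftP ord0 j) => [j' ->|->];
  rewrite ?(ord1 i') ?(ord1 j') ?s10 ?tA' -?val_eqE /=; field.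
Qed.

(** A^2 = s > 0 yields a unit eigenvector v for m = sqrt s. Anticommutation sends Bv to the
    eigenvalue -m, and B^2 = 1 + s fixes its norm; in the orthonormal basis v, Bv / sqrt (1 + s) the
    pair has the normal form. *)
Lemma hyperbolic_swap a : hyperbolic_atom a -> atom_size a = 2%N -> atom_X a != 0 ->
  orthogonally_equivalent_atoms a (swap_atom (Num.sqrt (atom_moment a [:: X; X]))).
Proof.
rewrite /atom_moment !word_evalE /=.
rewrite /hyperbolic_atom; case: a => n A B n0 sA sB /= hyp n2.
move: A B n0 sA sB hyp; rewrite n2.
move=> A B n0 sA sB hyp A0; have tA := hyperbolic_trace0 hyp; have [_ _ AB BB] := hyp.
have AA := traceless_sqr2 sA tA; set s := normalized_trace _ in AA *.
have s0 : 0 < s.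
  have s0 : 0 <= s by rewrite /s -{1}sA normalized_trace_gram_ge0.
  rewrite lt_neqAle s0 andbT; apply: contra A0 => /eqP {}s0.
  by apply/eqP/mxtrace_gram_eq0; rewrite sA AA -s0 raddf0 mxtrace0.
set m := Num.sqrt s; have m0 : 0 < m by rewrite sqrtr_gt0.
have mm : m * m = s by rewrite -expr2 sqr_sqrtr ?ltW.
set t := Num.sqrt (1 + m ^+ 2).
have t0 : 0 < t by rewrite sqrtr_gt0 ltr_wpDr ?sqr_ge0.
have tt : t * t = 1 + s by rewrite -expr2 sqr_sqrtr ?addr_ge0 ?sqr_ge0 // expr2 mm.
have [v [vv Av]] : exists v : 'cV[R]_2, v^T *m v = 1%:M /\ A *m v = m *: v.
  (* As (A - m)(A + m) = 0, every column of A + m is fixed by A up to the factor m; one is nonzero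
     because the trace is 2m. *)
  have [j uj] : exists j, col j (A + m%:M) != 0.
    apply/existsP; apply: contraT => /existsPn u0.
    have : \tr (A + m%:M) = 0.
      have -> : A + m%:M = 0; last by rewrite mxtrace0.
      apply/matrixP => i j; have := u0 j; rewrite negbK => /eqP/matrixP/(_ i 0).
      by rewrite [LHS]mxE => ->; rewrite !mxE.
    by rewrite linearD /= tA add0r mxtrace_scalar => /eqP; rewrite mulrn_eq0 (gt_eqF m0).
  set u := col j _ in uj *.
  have Au : A *m u = m *: u.
    rewrite /u colE !mulmxA scalemxAl; congr (_ *m _).
    by rewrite mulmxDr AA scalerDr scale_scalar_mx mm addrC mul_mx_scalar.
  have u0 : 0 < \tr (u^T *m u).
    rewrite lt_neqAle mxtrace_gram_ge0 andbT eq_sym.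
    by apply: contra uj => /eqP /mxtrace_gram_eq0 ->.
  exists ((Num.sqrt (\tr (u^T *m u)))^-1 *: u); split.
    rewrite [(_ *: _)^T]linearZ /= -scalemxAl -scalemxAr scalerA -invfM -expr2.
    rewrite sqr_sqrtr ?ltW //.
    rewrite [u^T *m u]mx11_scalar scale_scalar_mx mxtrace_scalar mulr1n mulVf //.
    by move: u0; rewrite {1}[u^T *m u]mx11_scalar mxtrace_scalar mulr1n => /gt_eqF ->.
  by rewrite -scalemxAr Au !scalerA mulrC.
set w := t^-1 *: (B *m v).
have Aw : A *m w = - m *: w.
  rewrite /w -scalemxAr mulmxA; move/eqP: AB; rewrite addr_eq0 => /eqP ->.
  by rewrite mulNmx -mulmxA Av -scalemxAr scalerN !scalerA mulNr scaleNr mulrC.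
have Bv : B *m v = t *: w by rewrite /w scalerA divff ?gt_eqF // scale1r.
have Bw : B *m w = t *: v.
  rewrite /w -scalemxAr mulmxA BB AA -raddfD /= mul_scalar_mx -tt scalerA.
  by rewrite mulrA mulVf ?gt_eqF // mul1r.
(* Eigenvectors of a symmetric matrix for the distinct eigenvalues m and -m are orthogonal. *)
have wv : w^T *m v = 0.
  have e1 : w^T *m A *m v = m *: (w^T *m v) by rewrite -mulmxA Av -scalemxAr.
  have e2 : w^T *m A *m v = - (m *: (w^T *m v)).
    by rewrite -{1}sA -trmx_mul Aw [(_ *: _)^T]linearZ /= -scalemxAl scaleNr.
  have E : (m + m) *: (w^T *m v) = 0 by rewrite scalerDl -{1}e1 e2 addNr.
  by move/eqP: E; rewrite scaler_eq0 gt_eqF ?addr_gt0 // => /eqP.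
have ww : w^T *m w = 1%:M.
  rewrite {1}/w [(_ *: _)^T]linearZ /= trmx_mul sB -scalemxAl -mulmxA Bw -scalemxAr scalerA.
  by rewrite vv mulVf ?gt_eqF // scale1r.
have vw : v^T *m w = 0 by rewrite -[LHS]trmxK trmx_mul trmxK wv trmx0.
pose V : 'M[R]_(2, 1 + 1) := row_mx v w.
have V1 : V^T *m V = 1%:M.
  by rewrite tr_row_mx mul_col_row vv ww vw wv -scalar_mx_block.
have V2 : V *m V^T = 1%:M by apply: (mulmx1C V1).
exists V^T; rewrite trmxK; split=> //=.
  have -> : swap_X m = V^T *m V *m swap_X m by rewrite V1 mul1mx.
  rewrite -!mulmxA; congr (_ *m _).
  rewrite mul_mx_row mul_row_block !mulmx0 addr0 add0r !mul_mx_scalar.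
  by rewrite Av Aw.
have -> : swap_Y m = V^T *m V *m swap_Y m by rewrite V1 mul1mx.
rewrite -!mulmxA; congr (_ *m _).
rewrite mul_mx_row mul_row_block !mulmx0 addr0 add0r !mul_mx_scalar.
by rewrite Bv Bw.
Qed.

End SmallAtoms.

(** * Types of measures, and matching of atoms by labels *)

Section Types.
Variable R : realType.
Implicit Types (mu nu : measure R) (beta : word -> R).

(** The counts are fixed by the measure, and the nonzero last entry fixes the length. *)
Lemma has_type_uniq mu m m' : has_type mu m -> has_type mu m' -> m = m'.
Proof.
move=> [l0 c] [l0' c'].
have nthE k : nth 0%N m k = nth 0%N m' k by rewrite -c -c'.
have le p q : last 0%N q != 0%N -> (forall k, nth 0%N p k = nth 0%N q k) ->
    (size q <= size p)%N.
  case: q => [//|h q] lq e; rewrite leqNgt; apply: contra lq => lt.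
  by rewrite -nth_last -e nth_default //= -ltnS.
apply: (@eq_from_nth _ 0%N) => [|k _]; last exact: nthE.
by apply/eqP; rewrite eqn_leq !le.
Qed.

(** The list of counts stops at the largest atom size, which is attained, so its last entry is
    nonzero. *)
Lemma has_type_exists mu : (0 < natoms mu)%N -> exists m, has_type mu m.
Proof.
move=> n0; pose s (i : 'I_(natoms mu)) := atom_size (atom_of i).
pose r := \max_i s i; pose i0 := Ordinal n0.
have s0 i : (0 < s i)%N := atom_size_gt0 _.
have [i1 _ rE] : {i1 | i1 \in 'I_(natoms mu) & r = s i1}.
  by apply: eq_bigmax_cond; rewrite card_ord.
exists (mkseq (fun k => #|[set i | s i == k.+1]|) r); split=> [|k].
  rewrite -nth_last size_mkseq nth_mkseq ?prednK ?ltnS //; last by rewrite rE.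
  - by rewrite -lt0n; apply/card_gt0P; exists i1; rewrite inE rE.
  - by rewrite rE.
have [kr|kr] := ltnP k r; first by rewrite nth_mkseq.
rewrite nth_default ?size_mkseq //; apply/eqP; rewrite cards_eq0.
apply/eqP/setP => i; rewrite !inE; apply/eqP => si.
by have := leq_bigmax (F := s) i; rewrite -/r /s si leqNgt ltnS kr.
Qed.

Lemma type_lt_antisym m m' : ~~ type_lt m m' -> ~~ type_lt m' m -> m = m'.
Proof.
rewrite /type_lt -!leNgt => le1 le2.
have : (size m :: rev m : seqlexi nat) = (size m' :: rev m' : seqlexi nat).
  by apply/eqP; rewrite eq_le le1 le2.
by case=> _ /(congr1 rev); rewrite !revK.
Qed.

Lemma bijection_of_keys (I J K : finType) (f : I -> K) (g : J -> K) :
  injective f -> injective g -> codom f =i codom g ->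
  exists h : I -> J, bijective h /\ forall i, g (h i) = f i.
Proof.
move=> fI gI fg.
have fP i : f i \in codom g by rewrite -fg codom_f.
have gP j : g j \in codom f by rewrite fg codom_f.
exists (fun i => iinv (fP i)); split=> [|i]; last exact: f_iinv.
exists (fun j => iinv (gP j)) => x.
  by apply: fI; rewrite !f_iinv.
by apply: gI; rewrite !f_iinv.
Qed.

End Types.

(** * The canonical measure with one atom of size 2 *)

Section Canonical.
Variables (R : realType) (y a c : R).

Definition canonical_atom (k : option bool) : atom R :=
  if k is Some e then point_atom R e else swap_atom (Num.sqrt (c / a)).

(* The noncommuting atom with A^2 = mu^2 and density l needs l mu^2 = a and     *)
(* l mu^4 = c; the two points share the mass 1 - l with difference y.           *)
Definition canonical_density (k : option bool) : R :=
  if k is Some e then (1 - a ^+ 2 / c + sign_of R e * y) / 2 else a ^+ 2 / c.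

(** A point of mass zero is dropped, since densities must be positive. *)
Definition canonical_support : {set option bool} := [set k | 0 < canonical_density k].

Definition canonical_measure : measure R :=
  @Measure R #|canonical_support| (fun i => canonical_atom (enum_val i))
           (fun i => canonical_density (enum_val i)).

Definition canonical_type : seq nat :=
  [:: #|[set k in canonical_support | k != None]|; 1%N].

Hypotheses (a_gt0 : 0 < a) (c_gt : a ^+ 2 < c) (y_le : `|y| <= 1 - a ^+ 2 / c).

Lemma canonical_c_gt0 : 0 < c.
Proof. exact: le_lt_trans (sqr_ge0 a) c_gt. Qed.

Let c_gt0 := canonical_c_gt0.

Lemma canonical_point_mass_gt0 : 0 < 1 - a ^+ 2 / c.
Proof. by rewrite subr_gt0 ltr_pdivrMr // mul1r. Qed.

Lemma canonical_None_gt0 : 0 < canonical_density None.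
Proof. by rewrite divr_gt0 ?exprn_gt0. Qed.

(** For the two points this is exactly the assumed bound on |y|. *)
Lemma canonical_density_ge0 k : 0 <= canonical_density k.
Proof.
case: k => [e|]; last exact: ltW canonical_None_gt0.
rewrite divr_ge0 //; move: y_le; rewrite ler_norml => /andP[y1 y2].
by case: e; rewrite /sign_of; lra.
Qed.

Lemma big_option_bool (F : option bool -> R) :
  \sum_k F k = F None + (F (Some true) + F (Some false)).
Proof.
rewrite (bigD1 None) //= (bigD1 (Some true)) //= (bigD1 (Some false)) //=.
by rewrite big1 ?addr0 // => -[[]|].
Qed.

Lemma canonical_sum (F : option bool -> R) :
  \sum_(i < natoms canonical_measure) density i * F (enum_val i) =
  \sum_k canonical_density k * F k.
Proof.
rewrite [RHS](bigID (mem canonical_support)) /= [X in _ + X]big1 ?addr0 => [|k].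
  by rewrite -(big_enum_val (fun k => canonical_density k * F k)).
rewrite inE -leNgt => k0; suff -> : canonical_density k = 0 by rewrite mul0r.
by apply/eqP; rewrite eq_le k0 canonical_density_ge0.
Qed.

Lemma canonical_hyperbolic k : hyperbolic_atom (canonical_atom k).
Proof. by case: k => [e|]; [exact: point_atom_hyperbolic|exact: swap_atom_hyperbolic]. Qed.

(** Both sides satisfy the relations, so comparing the moments of X, Y, X^2 and X^4 suffices. *)
Lemma canonical_representing (beta : word -> R) :
  relation_moments beta -> beta [:: X] = 0 -> beta [:: Y] = y ->
  beta [:: X; X] = a -> beta [:: X; X; X; X] = c ->
  representing_measure beta canonical_measure.
Proof.
move=> rel bX bY bXX bX4.
have d1 : \sum_i density (m := canonical_measure) i = 1.
  under eq_bigr do rewrite -[density _]mulr1.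
  by rewrite (canonical_sum (fun _ => 1)) big_option_bool /= /sign_of; field; rewrite gt_eqF.
split=> // [i|w sw].
  by have := enum_valP i; rewrite inE.
have relm : relation_moments (measure_moment canonical_measure).
  by apply: measure_relation_moments => // i; apply: canonical_hyperbolic.
have mE u : measure_moment canonical_measure u =
    \sum_k canonical_density k * atom_moment (canonical_atom k) u.
  exact: (canonical_sum (fun k => atom_moment (canonical_atom k) u)).
rewrite (relation_momentsE rel) // (relation_momentsE relm) // bX bY bXX bX4.
have [sX sY sXX sX4] := swap_atom_moments (Num.sqrt (c / a)).
have ca : Num.sqrt (c / a) ^+ 2 = c / a by rewrite sqr_sqrtr // divr_ge0 ?ltW.
have ca4 : Num.sqrt (c / a) ^+ 4 = (c / a) ^+ 2 by rewrite -[4%N]/(2 * 2)%N exprM ca.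
have [pX pY pXX pX4] := point_atom_moments R true.
have [qX qY qXX qX4] := point_atom_moments R false.
rewrite !mE !big_option_bool /= sX sY sXX sX4 pX pY pXX pX4 qX qY qXX qX4 ca ca4.
by congr moment_value; rewrite /sign_of; field; rewrite ?gt_eqF.
Qed.

Lemma canonical_has_type : has_type canonical_measure canonical_type.
Proof.
split=> // k.
have -> : #|[set i | atom_size (atom_of (m := canonical_measure) i) == k.+1]| =
          #|[set j in canonical_support | atom_size (canonical_atom j) == k.+1]|.
  by rewrite -!sum1_card !(eq_bigl _ _ (in_set _)) [RHS]big_enum_val_cond.
case: k => [|[|k]] /=; last first.
- by rewrite nth_nil; apply: eq_card0 => -[e|]; rewrite !inE andbF.
- apply: etrans (cards1 (None : option bool)).
  apply: eq_card => -[e|]; rewrite !inE /= ?andbF //.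
  by rewrite canonical_None_gt0.
by apply: eq_card => -[e|]; rewrite !inE.
Qed.

End Canonical.

(** * Every minimal measure is the canonical one *)

Section Rigidity.
Variable R : realType.
Implicit Types (mu nu : measure R).

Lemma has_type_size mu m (i : 'I_(natoms mu)) :
  has_type mu m -> (atom_size (atom_of i) <= size m)%N.
Proof.
move=> [_ cnt]; rewrite leqNgt; apply/negP => lt.
have := cnt (atom_size (atom_of i)).-1; rewrite prednK ?atom_size_gt0 //.
rewrite nth_default; last by rewrite -ltnS prednK ?atom_size_gt0.
by move/eqP; rewrite cards_eq0 => /eqP/setP/(_ i); rewrite !inE eqxx.
Qed.

(** Names the canonical atom to which a hyperbolic atom will be matched; all sizes above 1 share the
    key [None]. *)
Definition atom_key (b : atom R) : option bool :=
  if atom_size b == 1%N then Some (0 < \tr (atom_Y b)) else None.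

Lemma atom_key_None (b : atom R) : (atom_key b == None) = (atom_size b != 1%N).
Proof. by rewrite /atom_key; case: ifP. Qed.

Variable beta : word -> R.
Let y := beta [:: Y].
Let a := beta [:: X; X].
Let c := beta [:: X; X; X; X].
Hypotheses (rel : relation_moments beta) (bX : beta [:: X] = 0).
Hypotheses (a_gt0 : 0 < a) (c_gt : a ^+ 2 < c) (y_le : `|y| <= 1 - a ^+ 2 / c).

Let catom := canonical_atom a c.
Let cdens := canonical_density y a c.
Let ctype := canonical_type y a c.
Let cmeasure := canonical_measure y a c.

(** If the single atom of size 2 has density l and A^2 = s, then a = l s and c = l s^2, because
    points contribute to neither moment; this determines s and l. *)
Lemma minimal_candidate_structure mu m1 :
  representing_measure beta mu -> has_type mu [:: m1; 1%N] ->
  (forall i : 'I_(natoms mu),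
     orthogonally_equivalent_atoms (atom_of i) (catom (atom_key (atom_of i)))) /\
  (forall k, \sum_(i < natoms mu | atom_key (atom_of i) == k) density i = cdens k).
Proof.
move=> repm ty; have hyp := representing_hyperbolic rel repm.
have [d0 d1 rep] := repm.
(* Index 1 of the type counts the atoms of size 2, so [i0] is the only one. *)
have /eqP/cards1P[i0 /setP i0E] := (proj2 ty) 1%N.
have keyN i : (atom_key (atom_of i) == None) = (i == i0).
  have := i0E i; rewrite !inE => <-; rewrite atom_key_None.
  have := has_type_size i ty; have := atom_size_gt0 (atom_of i).
  by case: (atom_size _) => [|[|[|]]].
have key0 : atom_key (atom_of i0) = None by apply/eqP; rewrite keyN.
have pt i : i != i0 -> orthogonally_equivalent_atoms (atom_of i) (catom (atom_key (atom_of i))).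
  rewrite -keyN /atom_key; case: ifP => // /eqP s1 _.
  exact: hyperbolic_point (hyp i) s1.
have ptM w i : i != i0 ->
    atom_moment (atom_of i) w = atom_moment (catom (atom_key (atom_of i))) w.
  by move=> ii0; rewrite (atom_moment_equivalent _ (pt i ii0)).
have sum0 w : (forall e, atom_moment (point_atom R e) w = 0) -> (size w <= 4)%N ->
    beta w = density i0 * atom_moment (atom_of i0) w.
  move=> w0 sw; rewrite rep // /measure_moment (bigD1 i0) //= big1 ?addr0 // => i ii0.
  rewrite -/(atom_moment (atom_of i) w) ptM //.
  have := keyN i; rewrite (negPf ii0); case: (atom_key _) => // e _.
  by rewrite /= w0 mulr0.
set l := density i0; set s := atom_moment (atom_of i0) [:: X; X].
have l0 : 0 < l := d0 i0.
have aE : a = l * s.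
  by apply: sum0 => // e; have [] := point_atom_moments R e.
have s0 : 0 < s by move: a_gt0; rewrite aE pmulr_rgt0.
have eqv0 : orthogonally_equivalent_atoms (atom_of i0) (swap_atom (Num.sqrt s)).
  apply: hyperbolic_swap => //; first by have := i0E i0; rewrite !inE eqxx => /eqP.
  apply/eqP => x0; move: s0; rewrite /s /atom_moment !word_evalE x0 /= mul0mx.
  by rewrite /normalized_trace mxtrace0 mul0r ltxx.
have [sX sY sXX sX4] := swap_atom_moments (Num.sqrt s).
have cE : c = l * s ^+ 2.
  rewrite /c sum0 // => [|e]; last by have [] := point_atom_moments R e.
  rewrite -(atom_moment_equivalent _ eqv0) sX4 -/l.
  by rewrite -[4%N]/(2 * 2)%N exprM sqr_sqrtr ?ltW.
have sE : s = c / a by rewrite cE aE; field; rewrite !gt_eqF.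
have lE : l = a ^+ 2 / c by rewrite cE aE; field; rewrite !gt_eqF.
split=> [i|].
  have [->|] := eqVneq i i0; last exact: pt.
  by rewrite key0 /= -sE.
(* Points may repeat, so only the mass per key is determined: the total mass gives the sum over the
   two signs, the moment of Y the difference. *)
pose W k := \sum_(i < natoms mu | atom_key (atom_of i) == k) density i.
have W0 : W None = a ^+ 2 / c.
  by rewrite /W (eq_bigl _ _ keyN) big_pred1_eq -lE.
have W1 : W (Some true) + W (Some false) = 1 - W None.
  rewrite -d1 (partition_big (fun i => atom_key (atom_of i)) xpredT) //=.
  by rewrite big_option_bool /W [RHS]addrC addKr.
have Wy : W (Some true) - W (Some false) = y.
  rewrite /y rep // /measure_moment.
  rewrite (partition_big (fun i => atom_key (atom_of i)) xpredT) //= big_option_bool.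
  rewrite [X in _ = X + _](_ : _ = 0) ?add0r; last first.
    rewrite (eq_bigl _ _ keyN) big_pred1_eq -/(atom_moment _ _).
    by rewrite -(atom_moment_equivalent _ eqv0) sY mulr0.
  have We e : \sum_(i < natoms mu | atom_key (atom_of i) == Some e)
      density i * normalized_trace (word_eval (atom_X (atom_of i)) (atom_Y (atom_of i)) [:: Y])
    = W (Some e) * sign_of R e.
    rewrite /W mulr_suml; apply: eq_bigr => i /eqP ke; congr (_ * _).
    rewrite -/(atom_moment _ _) ptM ?ke; last by rewrite -keyN ke.
    by have [] := point_atom_moments R e.
  by rewrite !We /sign_of; ring.
rewrite W0 in W1 => -[[]|]; rewrite /cdens /= /sign_of -/(W _) //; lra.
Qed.

Lemma card_points mu : #|[set i : 'I_(natoms mu) | atom_key (atom_of i) != None]| =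
  #|[set i : 'I_(natoms mu) | atom_size (atom_of i) == 1%N]|.
Proof. by apply: eq_card => i; rewrite !inE /atom_key; case: ifP. Qed.

(** The mass at a key is the canonical density, and it is positive exactly when some atom carries
    that key. *)
Lemma key_image mu m1 :
  representing_measure beta mu -> has_type mu [:: m1; 1%N] ->
  [set atom_key (atom_of i) | i in [set i : 'I_(natoms mu) | atom_key (atom_of i) != None]]
  = [set k in canonical_support y a c | k != None].
Proof.
move=> repm ty; have [_ dE] := minimal_candidate_structure repm ty.
have [d0 _ _] := repm.
apply/setP => k; rewrite !inE -/cdens -dE; apply/imsetP/andP.
  move=> [i]; rewrite inE => ki ->; split=> //.
  rewrite (bigD1 i) //= ltr_pwDl ?d0 //.
  by apply: sumr_ge0 => j _; apply: ltW.
move=> [Wk kN]; have [i /eqP ki] : exists i : 'I_(natoms mu), atom_key (atom_of i) == k.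
  apply/existsP; apply: contraTT Wk => /existsPn nk.
  by rewrite big_pred0 ?ltxx // => i; apply/negbTE/nk.
by exists i; rewrite ?inE ki.
Qed.

Lemma candidate_type_ge mu m1 :
  representing_measure beta mu -> has_type mu [:: m1; 1%N] ->
  (#|[set k in canonical_support y a c | k != None]| <= m1)%N.
Proof.
move=> repm ty; rewrite -(key_image repm ty) (leq_trans (leq_imset_card _ _)) //.
by rewrite card_points (proj2 ty 0%N).
Qed.

(** Points alone would give a = 0, so atoms of size at least 2 occur. With a single one, of size 2,
    each supported point needs its own atom; all other types are larger. *)
Lemma canonical_type_le mu m : representing_measure beta mu -> has_type mu m ->
  ~~ type_lt m ctype.
Proof.
move=> repm ty; have hyp := representing_hyperbolic rel repm.
have sz i := has_type_size i ty.
case: m ty sz => [[] //|m1 [|m2 [|m3 m]]] ty sz.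
- have [_ _ rep] := repm; move: a_gt0; rewrite /a rep // /measure_moment big1 ?ltxx //.
  move=> i _; have s1 : atom_size (atom_of i) = 1%N.
    by apply/eqP; rewrite eqn_leq (sz i) atom_size_gt0.
  rewrite -/(atom_moment _ _) -(atom_moment_equivalent _ (hyperbolic_point (hyp i) s1)).
  by have [_ _ -> _] := point_atom_moments R (0 < \tr (atom_Y (atom_of i))); rewrite mulr0.
- rewrite /type_lt /ctype /canonical_type /= /rev /=.
  have m2_neq0 : m2 != 0%N by have [] := ty.
  rewrite !ltxi_cons !lexx /= ltxx implybF !leEnat.
  apply/negP => /andP[m2_le /implyP]; rewrite lt0n => /(_ m2_neq0)/andP[_ /negP]; apply.
  have m2E : m2 = 1%N by apply/eqP; rewrite eqn_leq m2_le lt0n.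
  by rewrite m2E in ty; apply: candidate_type_ge repm ty.
by rewrite /type_lt ltxi_cons leEnat.
Qed.

Lemma canonical_minimal : minimal_measure beta cmeasure.
Proof.
split; first exact: canonical_representing.
move=> nu m m' repn tm tn.
have -> : m = ctype by apply: has_type_uniq tm _; apply: canonical_has_type.
exact: canonical_type_le repn tn.
Qed.

Lemma minimal_has_canonical_type mu : minimal_measure beta mu -> has_type mu ctype.
Proof.
move=> [repm minm].
have [m ty] : exists m, has_type mu m.
  apply: has_type_exists; have [_ + _] := repm; case: (natoms mu) (@density _ mu) => //.
  by move=> d; rewrite big_ord0 => /esym/eqP; rewrite oner_eq0.
have cty : has_type cmeasure ctype by apply: canonical_has_type.
suff <- : m = ctype by [].
apply: type_lt_antisym; first exact: canonical_type_le repm ty.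
exact: minm (proj1 canonical_minimal) ty cty.
Qed.

(** Minimality leaves as many points as supported point keys, so no key repeats and each density is
    the whole mass of its key. *)
Lemma minimal_structure mu : minimal_measure beta mu ->
  [/\ injective (fun i : 'I_(natoms mu) => atom_key (atom_of i)),
      codom (fun i : 'I_(natoms mu) => atom_key (atom_of i)) =i canonical_support y a c,
      forall i : 'I_(natoms mu), density i = cdens (atom_key (atom_of i)) &
      forall i : 'I_(natoms mu),
        orthogonally_equivalent_atoms (atom_of i) (catom (atom_key (atom_of i)))].
Proof.
move=> minm; have ty := minimal_has_canonical_type minm; have [repm _] := minm.
have [eqv dE] := minimal_candidate_structure repm ty.
have [d0 _ _] := repm.
have inj : injective (fun i : 'I_(natoms mu) => atom_key (atom_of i)).
  (* A map whose image has the cardinality of its domain is injective. *)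
  have injS := imset_injP (f := fun i : 'I_(natoms mu) => atom_key (atom_of i))
     (D := mem [set i : 'I_(natoms mu) | atom_key (atom_of i) != None]).
  have {}/injS injS :
      #|[set atom_key (atom_of i)
          | i in [set i : 'I_(natoms mu) | atom_key (atom_of i) != None]]|
    == #|[set i : 'I_(natoms mu) | atom_key (atom_of i) != None]|.
    by rewrite (key_image repm ty) card_points (proj2 ty 0%N).
  have /eqP/cards1P[i0 /setP i0E] := (proj2 ty) 1%N.
  have keyN i : atom_key (atom_of i) = None -> i = i0.
    move=> kN; apply/eqP; have := i0E i; rewrite !inE => <-.
    move/eqP: kN; rewrite atom_key_None; have := has_type_size i ty.
    by have := atom_size_gt0 (atom_of i); case: (atom_size _) => [|[|[|]]].
  move=> i j /= ij; case kN : (atom_key (atom_of i)) => [e|].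
    by apply: injS => //; rewrite inE -?ij kN.
  by rewrite (keyN i kN) (keyN j) // -ij.
have dE' (i : 'I_(natoms mu)) : density i = cdens (atom_key (atom_of i)).
  have keyE (j : 'I_(natoms mu)) : (atom_key (atom_of j) == atom_key (atom_of i)) = (j == i).
    by apply/eqP/eqP => [/inj|->].
  by rewrite -dE (eq_bigl _ _ keyE) big_pred1_eq.
split=> // k; rewrite inE; apply/codomP/idP => [[i ->]|k0].
  by rewrite -/cdens -dE' d0.
case kN: k => [e|]; last first.
  have /eqP/cards1P[i0 /setP i0E] := (proj2 ty) 1%N.
  exists i0; apply/esym/eqP; rewrite atom_key_None.
  by have := i0E i0; rewrite !inE eqxx => /eqP ->.
have : k \in [set k in canonical_support y a c | k != None] by rewrite !inE k0 kN.
by rewrite -(key_image repm ty) => /imsetP[i _]; rewrite kN => ->; exists i.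
Qed.

(** Atoms with equal keys are equivalent to the same canonical atom and have its density. *)
Lemma minimal_unique : unique_minimal_measure beta.
Proof.
split; first by exists cmeasure; apply: canonical_minimal.
move=> mu nu /minimal_structure[injm codm dm em] /minimal_structure[injn codn dn en].
have [h [hbij hE]] := bijection_of_keys injm injn (fun k => etrans (codm k) (esym (codn k))).
exists h; split=> // i; rewrite dm dn hE; split=> //.
apply: orthogonally_equivalent_atoms_trans (em i) _; rewrite -hE.
exact: orthogonally_equivalent_atoms_sym.
Qed.

(** The point whose sign is opposite to that of y has mass zero. *)
Lemma canonical_type_extremal : `|y| = 1 - a ^+ 2 / c -> ctype = [:: 1; 1]%N.
Proof.
have c0 := canonical_c_gt0 c_gt; have p0 := canonical_point_mass_gt0 c_gt.
move=> yE; rewrite /ctype /canonical_type; congr [:: _; _].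
have [y0|y0] := leP 0 y.
  rewrite ger0_norm // in yE.
  apply: etrans (cards1 (Some true)); apply: eq_card => -[[]|]; rewrite !inE ?andbF //=.
  - by rewrite /sign_of yE andbT eqxx; lra.
  - by rewrite /sign_of yE andbT mulN1r subrr mul0r ltxx.
rewrite ltr0_norm // in yE.
apply: etrans (cards1 (Some false)); apply: eq_card => -[[]|]; rewrite !inE ?andbF //=.
- by rewrite /sign_of -yE andbT mul1r addNr mul0r ltxx.
- by rewrite /sign_of -yE andbT eqxx; lra.
Qed.

Lemma canonical_type_generic : `|y| <> 1 - a ^+ 2 / c -> ctype = [:: 2; 1]%N.
Proof.
move/eqP=> yE; have : `|y| < 1 - a ^+ 2 / c by rewrite lt_neqAle yE.
rewrite ltr_norml => /andP[y1 y2]; rewrite /ctype /canonical_type; congr [:: _; _].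
apply: (etrans (_ : _ = #|[set k : option bool | k != None]|)).
  apply: eq_card => -[[]|]; rewrite !inE ?andbF //= andbT /sign_of;
  by apply/idP; lra.
by rewrite cardsE cardC1 card_option card_bool.
Qed.

End Rigidity.

(** * Necessary conditions on the first moments *)

Section Necessity.
Variable R : realType.

Lemma representing_X_eq0 (beta : word -> R) mu : relation_moments beta ->
  representing_measure beta mu -> beta [:: X] = 0.
Proof.
move=> rel repm; have hyp := representing_hyperbolic rel repm; have [_ _ rep] := repm.
rewrite rep // /measure_moment big1 // => i _.
by rewrite !word_evalE /= /normalized_trace (hyperbolic_trace0 (hyp i)) mul0r mulr0.
Qed.

(** The trace bound of each atom, divided by its size and averaged; tau stays free to be
    optimized. *)
Lemma representing_Y_bound (beta : word -> R) mu (tau : R) : relation_moments beta ->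
  representing_measure beta mu ->
  `|beta [:: Y]| <= 1 - 2 * tau * beta [:: X; X] + tau ^+ 2 * beta [:: X; X; X; X].
Proof.
move=> rel repm; have hyp := representing_hyperbolic rel repm; have [d0 d1 rep] := repm.
suff : `|beta [:: Y]| <= beta [::] - 2 * tau * beta [:: X; X] + tau ^+ 2 * beta [:: X; X; X; X].
  by have [_ -> _ _] := rel.
rewrite !rep // /measure_moment !mulr_sumr -sumrB -big_split /=.
apply: le_trans (ler_norm_sum _ _ _) _; apply: ler_sum => i _.
rewrite normrM gtr0_norm //.
have distr (d p q r : R) :
    d * p - 2 * tau * (d * q) + tau ^+ 2 * (d * r) = d * (p - 2 * tau * q + tau ^+ 2 * r).
  by ring.
rewrite distr ler_pM2l //.
have n0 : 0 < (atom_size (atom_of i))%:R :> R by rewrite ltr0n atom_size_gt0.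
rewrite !word_evalE /= /normalized_trace normrM normfV (gtr0_norm n0) ler_pdivrMr //.
apply: le_trans (hyperbolic_trace_bound tau (hyp i)) _; rewrite mxtrace1 !mulmxA.
by rewrite le_eqVlt; apply/orP; left; apply/eqP; field; rewrite gt_eqF.
Qed.

End Necessity.

(** * The two cases and their minimal measures *)

Theorem theorem6p11 (R : realType) (beta : word -> R)
  (beta_seq : tracial_sequence4 beta)
  (beta_normalized : normalized beta)
  (beta_nc : nc_sequence beta)
  (rank5 : \rank (moment_matrix beta) = 5%N)
  (rel1 : moment_column beta [:: X; Y] + moment_column beta [:: Y; X] = 0)
  (rel2 : moment_column beta [:: Y; Y] - moment_column beta [:: X; X] =
          moment_column beta [::]) :
  let case1 :=
    [/\ positive_semidefinite (moment_matrix beta),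
        beta [:: X] = 0 & beta [:: Y] = 0] in
  let case2 :=
    [/\ positive_semidefinite (moment_matrix beta),
        beta [:: X] = 0, 0 < `|beta [:: Y]|, `|beta [:: Y]| < 1 &
        beta [:: X; X; X; X] >= beta [:: X; X] ^+ 2 / (1 - `|beta [:: Y]|)] in
  let extremal :=
    beta [:: X; X; X; X] = beta [:: X; X] ^+ 2 / (1 - `|beta [:: Y]|) in
  [/\ admits_nc_measure beta <-> case1 \/ case2,
      case1 ->
        unique_minimal_measure beta /\
        (forall mu, minimal_measure beta mu -> has_type mu [:: 2; 1]%N) &
      case2 ->
        [/\ unique_minimal_measure beta,
            forall mu, minimal_measure beta mu ->
              (has_type mu [:: 1; 1]%N <-> extremal) &
            forall mu, minimal_measure beta mu ->
              ~ extremal -> has_type mu [:: 2; 1]%N]].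
Proof.
move=> case1 case2 extremal.
have rel := column_relation_moments beta_seq beta_normalized rel1 rel2.
set y := beta [:: Y] in case1 case2 extremal *.
set a := beta [:: X; X] in case2 extremal *.
set c := beta [:: X; X; X; X] in case2 extremal *.
have pos : positive_semidefinite (moment_matrix beta) -> beta [:: X] = 0 ->
    0 < a /\ 0 < c.
  move=> psd bX; have [a0 ac] := psd_moments beta_normalized psd.
  have a_gt0 : 0 < a.
    by rewrite lt_neqAle a0 eq_sym (rank5_X2_neq0 beta_seq beta_normalized rank5 rel1 rel2 bX).
  by split=> //; apply: lt_le_trans ac; rewrite exprn_gt0.
(* Both cases meet the hypotheses of the canonical construction. Strictness of a^2 < c comes from
   the rank in the first case and from |y| > 0 in the second. *)
have good : case1 \/ case2 ->
    [/\ beta [:: X] = 0, 0 < a, a ^+ 2 < c & `|y| <= 1 - a ^+ 2 / c].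
  case=> [[psd bX y0]|[psd bX y0 y1 cE]]; have [a0 c0] := pos psd bX.
    have ac : a ^+ 2 < c.
      rewrite lt_neqAle (proj2 (psd_moments beta_normalized psd)) andbT eq_sym.
      exact: rank5_X4_neq beta_seq beta_normalized rank5 rel1 rel2 bX y0.
    by split=> //; rewrite y0 normr0 subr_ge0 ler_pdivrMr // mul1r ltW.
  have {}cE : a ^+ 2 <= c * (1 - `|y|) by rewrite -ler_pdivrMr // subr_gt0.
  split=> //; last by rewrite lerBrDr -lerBrDl ler_pdivrMr // mulrC.
  by apply: le_lt_trans cE _; rewrite gtr_pMr // ltrBlDr ltrDl.
have extremalE : case1 \/ case2 -> (extremal <-> `|y| = 1 - a ^+ 2 / c).
  move=> cs; have [bX a0 ac yle] := good cs.
  have c0 := canonical_c_gt0 ac.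
  have y1 : 0 < 1 - `|y|.
    by have : 0 < a ^+ 2 / c; [rewrite divr_gt0 ?exprn_gt0|lra].
  have y1' := gt_eqF y1; have c0' := gt_eqF c0.
  rewrite /extremal; split=> [cE|yE].
    by rewrite cE; field; rewrite y1' (gt_eqF a0).
  rewrite yE subKr invf_div mulrCA divff ?mulr1 //.
  by rewrite gt_eqF ?exprn_gt0.
have minT (cs : case1 \/ case2) mu :
    minimal_measure beta mu -> has_type mu (canonical_type y a c).
  by have [bX a0 ac yle] := good cs; apply: minimal_has_canonical_type.
have uniq (cs : case1 \/ case2) : unique_minimal_measure beta.
  by have [bX a0 ac yle] := good cs; apply: minimal_unique.
have typ21 (cs : case1 \/ case2) : ~ extremal -> canonical_type y a c = [:: 2; 1]%N.
  have [bX a0 ac yle] := good cs; rewrite extremalE //.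
  exact: canonical_type_generic.
split.
- split=> [[mu [m [[repm _] _ _]]]|cs]; last first.
    have [bX a0 ac yle] := good cs.
    exists (canonical_measure y a c), (canonical_type y a c); split=> //.
      exact: canonical_minimal.
    exact: canonical_has_type.
  have psd := measure_psd beta_seq repm.
  have bX := representing_X_eq0 rel repm.
  have [a0 c0] := pos psd bX.
  have yle : `|y| <= 1 - a ^+ 2 / c.
    (* The value tau = a / c minimizes the quadratic bound. *)
    have := representing_Y_bound (a / c) rel repm; rewrite -/y -/a -/c.
    have -> : 1 - 2 * (a / c) * a + (a / c) ^+ 2 * c = 1 - a ^+ 2 / c => //.
    by field; rewrite gt_eqF.
  have [y0|y0] := eqVneq y 0; [by left|right].
  have ac : 0 < a ^+ 2 / c by rewrite divr_gt0 ?exprn_gt0.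
  have y1 : `|y| < 1 by lra.
  split; rewrite ?normr_gt0 // ler_pdivrMr ?subr_gt0 //.
  by rewrite mulrC -ler_pdivrMr // lerBrDl -lerBrDr.
- move=> c1; split=> [|mu minm]; first by apply: uniq; left.
  rewrite -typ21; [by apply: minT => //; left|by left|].
  rewrite extremalE; last by left.
  (* In the first case |y| = 0 lies strictly below 1 - a^2 / c, so both points survive. *)
  have [_ _ ac _] := good (or_introl c1); have [_ _ ->] := c1.
  by rewrite normr0 => /esym/eqP; rewrite gt_eqF // canonical_point_mass_gt0.
- move=> c2; have cs : case1 \/ case2 by right.
  split=> [|mu minm|mu minm ne]; first exact: uniq.
    have ty := minT cs mu minm; split=> [ty'|].
      have [//|/eqP ne] := eqVneq c (a ^+ 2 / (1 - `|y|)).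
      by have := has_type_uniq ty ty'; rewrite typ21.
    rewrite extremalE // => yE.
    by rewrite -(canonical_type_extremal _ yE) //; have [] := good cs.
  by rewrite -typ21 //; apply: minT.
Qed.
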